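(* For every even $a$ and every odd $n$, the graph $\Pi^a_n$ is Hamiltonian, i.e. it contains a cycle that visits each vertex exactly once.
   Context: For integers $a\ge 1$ and $n\ge 0$, let $\mathcal{S}^a_n$ be the set of all words $\alpha_1\cdots\alpha_n$ of length $n$ over the alphabet $\{0,1,\dots,a\}$ such that the letter $a$ appears only immediately after a letter $0$ (so $\alpha_1\ne a$, and $\alpha_i=a$ implies $\alpha_{i-1}=0$). The metallic cube $\Pi^a_n$ is the simple graph with vertex set $\mathcal{S}^a_n$ in which two vertices $\alpha=\alpha_1\cdots\alpha_n$ and $\beta=\beta_1\cdots\beta_n$ are adjacent if and only if $\sum_{k=1}^n|\alpha_k-\beta_k|=1$, i.e. one is obtained from the other by replacing a single letter $k$ by $k+1$, where $0\le k\le a-1$.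
   Formalization: The case n = 1 is excluded (so n is odd and at least 3), because for n = 1 the graph is a path on the a vertices 0, ..., a-1 and contains no cycle. *)

(* Defs.v *)
(* MathComp world. *)
From mathcomp Require Import all_boot all_order all_algebra.
Import IntDist.

Set Implicit Arguments.
Unset Strict Implicit.
Unset Printing Implicit Defensive.

Definition is_metallic_word (a n : nat) (w : n.-tuple 'I_a.+1) : bool :=
  [forall i : 'I_n, (tnth w i == a :> nat) ==>
     [exists j : 'I_n, (j.+1 == i) && (tnth w j == 0 :> nat)]].

Definition metallic_word (a n : nat) : finType :=
  {w : n.-tuple 'I_a.+1 | is_metallic_word w}.

(* [`|p - q|%N] is the absolute difference of two naturals, not the truncated
   subtraction. *)
Definition metallic_cube (a n : nat) : rel (metallic_word a n) :=
  fun u v => \sum_(k < n) `|tnth (val u) k - tnth (val v) k|%N == 1.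

Lemma metallic_cube_sym (a n : nat) : symmetric (@metallic_cube a n).
Proof.
move=> u v; rewrite /metallic_cube.
by congr (_ == _); apply: eq_bigr => k _; rewrite distnC.
Qed.

Lemma metallic_cube_irr (a n : nat) : irreflexive (@metallic_cube a n).
Proof. by move=> u; rewrite /metallic_cube big1 // => k _; rewrite distnn. Qed.

(* A cycle of a simple graph has at least three vertices; without the size
   condition the closed walk x, y, x along a single edge would be accepted. *)
Definition hamiltonian (V : finType) (e : rel V) : Prop :=
  exists c : seq V, [/\ 2 < size c, cycle e c, uniq c & forall x : V, x \in c].

(* Main.v *)
Require Import Defs.
From mathcomp Require Import all_boot all_order all_algebra zify.
Import IntDist.

Set Implicit Arguments.
Unset Strict Implicit.
Unset Printing Implicit Defensive.

(** Let [a = b + 2] with [b] even, write [W m] for the set of metallic words of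
    length [m], and sort the words of length [m + 1] by first letter. For
    [1 <= k < a] the layer of the words [k w] is a copy of [W m], and
    consecutive layers are joined by a perfect matching. Layer [0] is such a
    copy together with the words [0 a w], [w] in [W (m - 1)], each of which is
    linked to layer [0] through [0 (a - 1) w].

    A Hamiltonian path [H] of [W m] that runs from [x] to [y] is therefore
    extended to length [m + 1] in three moves: cover layer [0], ending at
    [0 x]; traverse layer [1] along [H], layer [2] along the reverse of [H],
    and so on, changing layer at the ends of [H]. As [a - 1] is odd, the whole
    last layer is traversed along [H], so the new path ends with the path
    [(a - 1) H]. This is what allows layer [0] to be covered at the next stage:
    the reverse of the path just built starts with [a - 1] followed by the
    reverse of [H], and prefixed by [0] these words form a ladder with their
    neighbours [0 a w], which is swept by a zigzag ([walk_zigzag]). The two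
    sequences, the Hamiltonian path and the path covering layer [0], are built
    by a simultaneous recursion ([strands]).

    The zigzag has to leave the ladder on the rung end [0 (a - 1) x], so its
    first vertex depends on the parity of the number of rungs, which is the
    size of [W m]. As [a] is even, [W m] has even size exactly when [m] is
    odd. Hence for [m] even and positive the path covering layer [0] of the
    words of length [m + 1] starts at [0 y], where [y] is the last word of
    [H]. The Hamiltonian cycle then goes through layer [0], sweeps the layers
    [1], ..., [a - 1] along [H] deprived of [y], and comes back to [0 y]
    through the column [(a - 1) y], ..., [1 y] ([ham_cycle_exists]).

    That these sequences contain each word exactly once is a computation of
    multiplicities ([count_strands]): these add up over concatenation, ignore
    reversals, and follow the first letter. *)

Implicit Types (a b j k m n : nat) (u v w x y : seq nat) (s t : seq (seq nat)).

(** * Words and their adjacency *)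

(** Words are first handled as plain sequences of naturals. After a letter [p]
    the next letter is below [a], or below [a.+1] when [p = 0]; starting
    from the fictitious letter [1] forbids [a] in front. *)
Definition metallic a w : bool := path (fun p q => q < a + (p == 0)) 1 w.

(** Continuations of a word whose last letter is [0]. *)
Definition after_zero a w : bool := path (fun p q => q < a + (p == 0)) 0 w.

Lemma metallic_cons a p w :
  metallic a (p :: w) =
  (p < a) && (if p is 0 then after_zero a w else metallic a w).
Proof. by rewrite /metallic /= addn0; case: p => // p; case: w. Qed.

Lemma after_zero_cons a p w :
  after_zero a (p :: w) =
  (p <= a) && (if p is 0 then after_zero a w else metallic a w).
Proof.
by rewrite /after_zero /metallic /= addn1 ltnS; case: p => // p; case: w.
Qed.

(** The maximum of the sizes makes the distance symmetric also on words of
    different lengths. *)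
Definition letter_dist u v : nat :=
  \sum_(k < maxn (size u) (size v)) `|nth 0 u k - nth 0 v k|%N.

Definition adj : rel (seq nat) := fun u v => letter_dist u v == 1.

Lemma letter_dist_cons p q u v :
  letter_dist (p :: u) (q :: v) = `|p - q|%N + letter_dist u v.
Proof. by rewrite /letter_dist /= maxnSS big_ord_recl. Qed.

Lemma letter_dist_refl u : letter_dist u u = 0.
Proof. by rewrite /letter_dist big1 // => k _; rewrite distnn. Qed.

Lemma adj_sym u v : adj u v = adj v u.
Proof.
rewrite /adj /letter_dist maxnC.
by congr (_ == _); apply: eq_bigr => k _; rewrite distnC.
Qed.

Lemma adj_cons k u v : adj (k :: u) (k :: v) = adj u v.
Proof. by rewrite /adj letter_dist_cons distnn. Qed.

Lemma adj_up k u : adj (k :: u) (k.+1 :: u).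
Proof. by rewrite /adj letter_dist_cons letter_dist_refl; lia. Qed.

Lemma adj_down k u : adj (k.+1 :: u) (k :: u).
Proof. by rewrite adj_sym adj_up. Qed.

(** * Walks with prescribed ends *)

Definition walk x y s : bool :=
  if s is z :: s' then [&& z == x, path adj z s' & last z s' == y] else false.

Lemma walk1 x : walk x x [:: x].
Proof. by rewrite /= eqxx. Qed.

Lemma walk2 x y : adj x y -> walk x y [:: x; y].
Proof. by rewrite /= !eqxx => ->. Qed.

Lemma walk_cat x y x' y' s t :
  walk x y s -> walk x' y' t -> adj y x' -> walk x y' (s ++ t).
Proof.
case: s => // z s /and3P[/eqP-> ps /eqP ls].
case: t => // z' t /and3P[/eqP-> pt /eqP lt] h.
by rewrite /= eqxx cat_path ps ls /= h pt last_cat /= lt eqxx.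
Qed.

Lemma walk_rev x y s : walk x y s -> walk y x (rev s).
Proof.
elim: s x => // z s IH x /and3P[/eqP-> ps ls].
rewrite rev_cons -cats1.
case: s IH ps ls => [_ _ /= /eqP->|z' s IH /andP[h ps] ls]; first exact: walk1.
have ws : walk z' y (z' :: s) by apply/and3P.
by apply: (walk_cat (IH z' ws) (walk1 x)); rewrite adj_sym.
Qed.

Lemma walk_map k x y s : walk x y s -> walk (k :: x) (k :: y) (map (cons k) s).
Proof.
case: s => // z s /and3P[/eqP-> ps /eqP ls].
rewrite /= eqxx last_map ls eqxx andbT /= path_map.
by rewrite (eq_path (e' := adj)) // => u v; rewrite /= adj_cons.
Qed.

(** * Building blocks *)

Fixpoint snake j s : seq (seq nat) :=
  if j is j'.+1 then
    snake j' s ++ map (cons j'.+1) (if odd j' then rev s else s)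
  else [::].

(** The last word is known from the parity of [j] alone, since consecutive
    layers are traversed in opposite directions. *)
Lemma walk_snake j u x y s t :
  walk u (0 :: x) t -> walk x y s ->
  walk u (j :: if odd j then y else x) (t ++ snake j s).
Proof.
move=> wt ws; elim: j => [|j IH] /=; first by rewrite cats0.
rewrite catA; apply: (walk_cat IH); last exact: adj_up.
by case: odd; apply: walk_map => //=; apply: walk_rev.
Qed.

Lemma size_snake j s : size (snake j s) = j * size s.
Proof.
elim: j => //= j IH.
by rewrite size_cat size_map IH; case: odd; rewrite ?size_rev; lia.
Qed.

Lemma count_map_cons k w s :
  count_mem w (map (cons k) s) =
  if w is p :: w' then (p == k) * count_mem w' s else 0.
Proof.
rewrite count_map; case: w => [|p w] /=.
  by rewrite (eq_count (a2 := pred0)) ?count_pred0.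
rewrite (eq_count (a2 := fun x => (k == p) && (x == w))) // eq_sym.
by case: (p == k); rewrite /= ?count_pred0 ?mul1n.
Qed.

Lemma count_snake j s w :
  count_mem w (snake j s) =
  if w is p :: w' then (0 < p <= j) * count_mem w' s else 0.
Proof.
elim: j => [|j IH] /=.
  by case: w => // -[].
rewrite count_cat IH count_map_cons; case: w {IH} => // p w.
have -> : count_mem w (if odd j then rev s else s) = count_mem w s.
  by case: odd; rewrite ?count_rev.
by rewrite -mulnDl; congr (_ * _); lia.
Qed.

(** The direction in which a rung is crossed is fixed by the number of rungs
    that remain, so that the last one always ends on the side of [k]. *)
Fixpoint zigzag k s : seq (seq nat) :=
  if s is x :: s' then
    (if odd (size s') then [:: [:: 0, k & x]; [:: 0, k.+1 & x]]
     else [:: [:: 0, k.+1 & x]; [:: 0, k & x]]) ++ zigzag k s'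
  else [::].

Lemma walk_zigzag k x y s : walk x y s ->
  walk [:: 0, (if odd (size s) then k.+1 else k) & x] [:: 0, k & y] (zigzag k s).
Proof.
elim: s x => // z s IH x /and3P[/eqP-> ps ls].
case: s IH ps ls => [_ _ /= /eqP->|z' s IH /andP[h ps] ls].
  by apply: walk2; rewrite adj_cons adj_down.
have ws : walk z' y (z' :: s) by apply/and3P.
have {IH ws} : walk [:: 0, (if ~~ odd (size s) then k.+1 else k) & z']
    [:: 0, k & y] (zigzag k (z' :: s)) := IH z' ws.
rewrite [zigzag _ (x :: _)]/= -/(zigzag k (z' :: s)) [odd (size (x :: _))]/=.
case: (odd (size s)) => wt; apply: (walk_cat (walk2 _) wt);
  by rewrite ?adj_cons // ?adj_up ?adj_down.
Qed.

Lemma size_zigzag k s : size (zigzag k s) = (size s).*2.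
Proof. by elim: s => //= x s IH; rewrite size_cat IH; case: odd. Qed.

Lemma count_zigzag k s w :
  count_mem w (zigzag k s) =
  if w is [:: p, q & w'] then
    (p == 0) * ((q == k) + (q == k.+1)) * count_mem w' s
  else 0.
Proof.
(* Up to order, a zigzag consists of the two sides of the ladder. *)
transitivity (count_mem w (map (cons 0) (map (cons k) s))
              + count_mem w (map (cons 0) (map (cons k.+1) s))).
  elim: s => //= x s IH; rewrite count_cat IH.
  by case: odd => /=; lia.
rewrite !count_map_cons; case: w => // p w; rewrite !count_map_cons.
by case: w => [|q w]; lia.
Qed.

(** * The Hamiltonian path and the covering of layer 0 *)

(** The alphabet is [0], ..., [b + 2]. With [h] and [z] the two components at
    [m], the path at [m + 1] is [z ++ snake b h] followed by the layer
    [(b + 1) h]; its reverse thus consists of the words [b + 1] followed by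
    [rev h], and then of [rev (z ++ snake b h)]. Once prefixed by [0], only the
    words of the first part have a neighbour beginning with [0, b + 2], hence
    the zigzag on them. *)
Fixpoint strands b m : seq (seq nat) * seq (seq nat) :=
  if m is m'.+1 then
    let: (h, z) := strands b m' in
    (z ++ snake b.+1 h,
     zigzag b.+1 (rev h) ++ map (cons 0) (rev (z ++ snake b h)))
  else ([:: [::]], [:: [:: 0]]).

Definition ham_path b m := (strands b m).1.
Definition zero_path b m := (strands b m).2.

Lemma ham_pathS b m :
  ham_path b m.+1 = zero_path b m ++ snake b.+1 (ham_path b m).
Proof. by rewrite /ham_path /zero_path /=; case: (strands b m). Qed.

Lemma zero_pathS b m :
  zero_path b m.+1 = zigzag b.+1 (rev (ham_path b m))
    ++ map (cons 0) (rev (zero_path b m ++ snake b (ham_path b m))).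
Proof. by rewrite /ham_path /zero_path /=; case: (strands b m). Qed.

(** A layer adds the size of [ham_path b m]; as there are [b + 1] of them
    besides layer [0], and layer [0] has odd size, the parity alternates. *)
Lemma odd_size_strands b m : ~~ odd b ->
  odd (size (ham_path b m)) = ~~ odd m /\ odd (size (zero_path b m)).
Proof.
move=> /negbTE b_even; elim: m => // m [IHh IHz].
rewrite ham_pathS zero_pathS !(size_cat, size_map, size_rev, size_snake).
rewrite size_zigzag !oddD !oddM odd_double /= b_even IHh IHz.
by case: (odd m).
Qed.

Lemma size_ham_path b m : ~~ odd b -> m < size (ham_path b m).
Proof.
move=> b_even; elim: m => // m IH.
rewrite ham_pathS size_cat size_snake.
have [_] := odd_size_strands m b_even.
by case: (size (zero_path b m)) => // k _; nia.
Qed.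

(** The second path ends at [0 x], next to the word [1 x] at which [snake]
    starts. The last clause is what closes the cycle: for [m] even and
    positive the zigzag has an even number of rungs, hence starts on the side
    of [b + 1], on the word [0 y]. *)
Lemma strands_walk b m : ~~ odd b -> exists x y z,
  [/\ walk x y (ham_path b m), walk z (0 :: x) (zero_path b m)
    & ~~ odd m -> 0 < m -> z = 0 :: y].
Proof.
move=> b_even; elim: m => [|m [x [y [z [wh wz _]]]]].
  by exists [::], [::], [:: 0].
(* The zigzag runs along the reverse of the path, hence starts above [y]; its
   number of rungs is odd when [m] is even. *)
exists z, (b.+1 :: y), [:: 0, (if odd m then b.+1 else b.+2) & y].
split.
- rewrite ham_pathS; have := walk_snake b.+1 wz wh.
  by rewrite /= b_even.
- rewrite zero_pathS.
  have := walk_zigzag b.+1 (walk_rev wh); rewrite size_rev.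
  have [-> _] := odd_size_strands m b_even.
  rewrite if_neg => w1.
  apply: (walk_cat w1); first exact: walk_map (walk_rev (walk_snake b wz wh)).
  by rewrite adj_cons (negbTE b_even) adj_down.
- by rewrite /= negbK => ->.
Qed.

(** Stating a multiplicity, which is [0] or [1] according to a boolean, gives
    membership and absence of repetition at once. *)
Lemma count_strands b m :
  (forall w, count_mem w (ham_path b m) = (size w == m) && metallic b.+2 w)
  /\ (forall w, count_mem w (zero_path b m) =
        if w is p :: w' then [&& p == 0, size w' == m & after_zero b.+2 w']
        else false).
Proof.
elim: m => [|m [IHh IHz]].
  by split=> -[|[|p] [|q w]].
split=> w.
  rewrite ham_pathS count_cat IHz count_snake; case: w => // p w.
  rewrite IHh eqSS metallic_cons.
  case: p => [|p]; first by rewrite /= mul0n addn0.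
  by case: (size w == m); case: metallic; lia.
rewrite zero_pathS count_cat count_zigzag count_map_cons.
case: w => // p [|q w].
  by rewrite count_rev count_cat IHz count_snake; case: p.
rewrite !count_rev count_cat IHz count_snake IHh after_zero_cons eqSS.
move: (after_zero b.+2 w) (metallic b.+2 w) (size w == m) => za me sz.
by case: p => [|p]; case: q => [|q]; case: za; case: me; case: sz; lia.
Qed.

(** * Closing the path into a cycle *)

Fixpoint column j x : seq (seq nat) :=
  if j is j'.+1 then (j :: x) :: column j' x else [::].

Lemma walk_column j x : walk (j.+1 :: x) (1 :: x) (column j.+1 x).
Proof.
elim: j => [|j IH]; first exact: walk1.
exact: (walk_cat (walk1 _) IH (adj_down _ _)).
Qed.

(** The cycle permutes the vertices of the Hamiltonian path, and so inherits
    their multiplicities. *)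
Lemma perm_snake_column j x s :
  perm_eq (snake j s ++ column j x) (snake j (rcons s x)).
Proof.
apply/permP => P; rewrite count_cat; elim: j => //= j IH.
rewrite !count_cat -IH !count_map.
by case: odd; rewrite ?count_rev -?cats1 ?count_cat /=; lia.
Qed.

Lemma walk_rcons x y v u s : walk x y (rcons (u :: s) v) ->
  v = y /\ exists2 y', walk x y' (u :: s) & adj y' y.
Proof.
rewrite /= rcons_path last_rcons => /and3P[-> /andP[-> h] /eqP vy].
by split=> //; exists (last u s); rewrite ?eqxx // -vy.
Qed.

Lemma walk_cycle x y s : walk x y s -> adj y x -> cycle adj s.
Proof.
by case: s => // z s /and3P[/eqP-> ps /eqP ls] h; rewrite /= rcons_path ps ls.
Qed.

(** For [m = 0] the only word of length [m] is [y] itself; nothing is left to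
    sweep once it is removed, and the graph at length [1] is a path. *)
Lemma ham_cycle_exists b m : ~~ odd b -> ~~ odd m -> 0 < m ->
  exists c, [/\ 2 < size c, cycle adj c & perm_eq c (ham_path b m.+1)].
Proof.
move=> b_even m_even m_gt0.
have [x [y [z [wh wz /(_ m_even m_gt0) zE]]]] := strands_walk m b_even.
have [_ odd_z] := odd_size_strands m b_even.
have := leq_ltn_trans m_gt0 (size_ham_path m b_even).
rewrite ham_pathS; case/lastP: (ham_path b m) wh => [|[|u s] v] // wh _.
have [vE [y' wB adj_y]] := walk_rcons wh; rewrite {}vE {v wh}.
have wc := walk_snake b.+1 wz wB; rewrite /= b_even in wc.
rewrite -(adj_cons b.+1) in adj_y.
exists (zero_path b m ++ snake b.+1 (u :: s) ++ column b.+1 y); split.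
- by have := odd_gt0 odd_z; rewrite size_cat size_cat size_snake mulSn /=; lia.
- rewrite catA; apply: (walk_cycle (walk_cat wc (walk_column b y) adj_y)).
  by rewrite zE adj_down.
- by rewrite perm_cat2l perm_snake_column.
Qed.

(** * Transfer to the metallic cube *)

Definition letters a n (w : n.-tuple 'I_a.+1) : seq nat := map val w.

Lemma nth_letters a n (w : n.-tuple 'I_a.+1) (i : 'I_n) :
  nth 0 (letters w) i = tnth w i.
Proof. by rewrite (nth_map (tnth w i)) ?size_tuple // -tnth_nth. Qed.

Lemma size_letters a n (w : n.-tuple 'I_a.+1) : size (letters w) = n.
Proof. by rewrite size_map size_tuple. Qed.

Lemma letters_inj a n : injective (@letters a n).
Proof. by move=> v w /(inj_map val_inj) /val_inj. Qed.

Lemma letter_dist_letters a n (v w : n.-tuple 'I_a.+1) :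
  letter_dist (letters v) (letters w) = \sum_(k < n) `|tnth v k - tnth w k|%N.
Proof.
rewrite /letter_dist !size_letters maxnn.
by apply: eq_bigr => k _; rewrite !nth_letters.
Qed.

Lemma metallic_letters a n (w : n.-tuple 'I_a.+1) :
  metallic a (letters w) = is_metallic_word w.
Proof.
apply/(pathP 0)/forallP => [w_ok i|w_ok i]; last rewrite size_letters => i_n.
  apply/implyP => /eqP wi; have := w_ok i; rewrite size_letters nth_letters wi.
  case: i wi => -[|i] i_n wi /(_ i_n) /=; first by rewrite addn0 ltnn.
  pose j := Ordinal (ltnW i_n); rewrite (nth_letters w j) => h.
  by apply/existsP; exists j; move: h; rewrite eqxx /=; case: eqP => //; lia.
have := w_ok (Ordinal i_n); rewrite -(nth_letters w (Ordinal i_n)) /=.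
have : nth 0 (letters w) i <= a.
  by rewrite (nth_letters w (Ordinal i_n)) -ltnS.
rewrite leq_eqVlt => /orP[/eqP-> |]; last by lia.
rewrite eqxx => /existsP[j /andP[/eqP <-]] /=.
by rewrite nth_letters => ->; lia.
Qed.

Lemma lettersP a n u : size u = n -> metallic a u ->
  exists w : metallic_word a n, letters (val w) = u.
Proof.
move=> u_n u_ok.
have u_le : all (fun p => p < a.+1) u.
  rewrite /metallic in u_ok.
  elim: u 1 {u_n} u_ok => //= p u IH q /andP[p_lt /IH ->].
  by rewrite andbT; move: p_lt; case: (q == 0); lia.
have s_n : size (map (@inord a) u) == n by rewrite size_map u_n.
have wE : letters (Tuple s_n) = u.
  rewrite /letters /= -map_comp -[RHS]map_id; apply/eq_in_map => p /(allP u_le).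
  exact: inordK.
have w_ok : is_metallic_word (Tuple s_n) by rewrite -metallic_letters wE.
by exists (Sub (Tuple s_n) w_ok); rewrite SubK.
Qed.

Theorem theorem12 (a n : nat) (a_ge1 : 1 <= a) (a_even : ~~ odd a)
    (n_odd : odd n) (n_neq1 : n <> 1) :
  hamiltonian (@metallic_cube a n).
Proof.
case: a a_ge1 a_even => [|[|b]] //= _; rewrite negbK => b_even.
case: n n_odd n_neq1 => //= m m_even m_neq0.
have m_gt0 : 0 < m by lia.
have [c [c_size c_cycle /permP c_perm]] := ham_cycle_exists b_even m_even m_gt0.
pose enc (w : metallic_word b.+2 m.+1) := letters (val w).
have enc_inj : injective enc by move=> v w /letters_inj/val_inj.
have c_count u : count_mem u c = (size u == m.+1) && metallic b.+2 u.
  by rewrite c_perm (count_strands b m.+1).1.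
have mem_c u : (u \in c) = (size u == m.+1) && metallic b.+2 u.
  by rewrite -has_pred1 has_count c_count; case: (_ && _).
(* The elements of [c] are encodings, so the cycle can be pulled back. *)
have lift s : {subset s <= c} -> exists d, s = map enc d.
  elim: s => [|u s IH] s_c; first by exists [::].
  have [|d ->] := IH; first by move=> v v_s; apply: s_c; rewrite inE v_s orbT.
  have := s_c u (mem_head _ _); rewrite mem_c => /andP[/eqP u_n u_ok].
  by have [w <-] := lettersP u_n u_ok; exists (w :: d).
have [//|d cE] := lift c.
exists d; split.
- by rewrite -(size_map enc) -cE.
- move: c_cycle; rewrite cE cycle_map; apply: sub_cycle => v w /=.
  by rewrite /adj letter_dist_letters.
- rewrite -(map_inj_uniq enc_inj) -cE; apply: count_mem_uniq => u.
  by rewrite mem_c c_count.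
- move=> w; rewrite -(mem_map enc_inj) -cE mem_c size_letters eqxx.
  by rewrite metallic_letters (valP w).
Qed.
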